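(* Let $n$ be a positive integer and let $F:\{0,1\}^n\times\{0,1\}^n\to\{0,1\}$ be a Boolean function. For all $\varepsilon\in(0,1/2)$ and all $\delta\in(0,1]$, $$\mathsf{R}^{\mathsf{pri}}_{\varepsilon(1+\delta)}(F)\le \mathsf{R}^{\mathsf{pub}}_{\varepsilon}(F)+\log\left(\frac{n}{\varepsilon}\right)+\log\left(\frac{6}{\delta^2}\right).$$
   Context: All logarithms are base 2. Alice holds $x\in\{0,1\}^n$, Bob holds $y\in\{0,1\}^n$, and they run a (possibly interactive) randomized communication protocol agreed upon in advance to compute $F(x,y)$; at the end a player outputs a bit. The players are computationally unbounded. In the public-coin model both players see a common random string $r$, drawn independently of the inputs at the start. In the private-coin model each player only has their own independent random string. A protocol computes $F$ with error $\varepsilon$ if for every $(x,y)$ the output differs from $F(x,y)$ with probability at most $\varepsilon$ over the randomness. The cost of a protocol is the worst-case (over inputs and randomness) amount of communication, where sending a message from a set of $B$ possible messages costs $\log B$ (no rounding to an integer number of bits). $\mathsf{R}^{\mathsf{pub}}_{\varepsilon}(F)$ and $\mathsf{R}^{\mathsf{pri}}_{\varepsilon}(F)$ denote the minimum cost of a public-coin, respectively private-coin, protocol computing $F$ with error $\varepsilon$. *)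

(* Defs.v *)
From mathcomp Require Import all_boot all_order all_algebra.
From mathcomp Require Import all_classical all_reals all_analysis.

Set Implicit Arguments.
Unset Strict Implicit.
Unset Printing Implicit Defensive.

Import Order.TTheory GRing.Theory Num.Theory.

Local Open Scope classical_set_scope.
Local Open Scope ring_scope.

Definition log2 (R : realType) (x : R) : R := ln x / ln 2.

(* Protocol trees in which Alice's view is an element of [A] and Bob's view an
   element of [B] (a view is an input, possibly together with a random string).
   At a [SendA] node Alice chooses one of the b.+1 >= 1 possible messages as a
   function of her view, and the protocol continues in the corresponding
   subtree, so that the speaker and the message set depend only on the
   transcript.  At a leaf one of the two players outputs a bit. *)
Inductive protocol (A B : Type) : Type :=
| OutA (o : A -> bool)
| OutB (o : B -> bool)
| SendA (b : nat) (m : A -> 'I_b.+1) (k : 'I_b.+1 -> protocol A B)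
| SendB (b : nat) (m : B -> 'I_b.+1) (k : 'I_b.+1 -> protocol A B).

Fixpoint output (A B : Type) (p : protocol A B) (u : A) (v : B) : bool :=
  match p with
  | OutA o => o u
  | OutB o => o v
  | SendA b m k => output (k (m u)) u v
  | SendB b m k => output (k (m v)) u v
  end.

Fixpoint comm (R : realType) (A B : Type) (p : protocol A B) (u : A) (v : B)
    : R :=
  match p with
  | OutA _ | OutB _ => 0
  | SendA b m k => log2 b.+1%:R + comm R (k (m u)) u v
  | SendB b m k => log2 b.+1%:R + comm R (k (m v)) u v
  end.

(* Public coins: the common random string w is a point of an arbitrary
   probability space.  As both players know w, everything in the protocol may
   depend on it, including the shape of the tree. *)
Record pub_protocol (R : realType) (X Y : Type) := PubProtocol {
  pub_disp : measure_display;
  pub_space : measurableType pub_disp;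
  pub_prob : probability pub_space R;
  pub_tree : pub_space -> protocol X Y;
  pub_meas : forall x y,
    measurable_fun setT (fun w : pub_space => output (pub_tree w) x y)
}.
Arguments pub_prob {R X Y} p : rename.
Arguments pub_tree {R X Y} p w : rename.

Definition pub_computes (R : realType) (X Y : Type) (F : X -> Y -> bool)
    (eps : R) (p : pub_protocol R X Y) : Prop :=
  forall x y,
    (pub_prob p [set w | output (pub_tree p w) x y != F x y] <= eps%:E)%E.

Definition pub_cost (R : realType) (X Y : Type) (p : pub_protocol R X Y)
    : \bar R :=
  ereal_sup [set (comm R (pub_tree p t.2) t.1.1 t.1.2)%:E
            | t in [set: (X * Y) * pub_space p]].

Fixpoint measurable_protocol (dA dB : measure_display)
    (SA : measurableType dA) (SB : measurableType dB) (X Y : Type)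
    (p : protocol (X * SA) (Y * SB)) : Prop :=
  match p with
  | OutA o => forall x, measurable_fun setT (fun r : SA => o (x, r))
  | OutB o => forall y, measurable_fun setT (fun r : SB => o (y, r))
  | SendA b m k =>
      (forall x j, measurable [set r : SA | m (x, r) = j]) /\
      (forall j, measurable_protocol (k j))
  | SendB b m k =>
      (forall y j, measurable [set r : SB | m (y, r) = j]) /\
      (forall j, measurable_protocol (k j))
  end.

(* Private coins: one fixed tree, and each player's view is that player's input
   together with that player's own random string. *)
Record pri_protocol (R : realType) (X Y : Type) := PriProtocol {
  pri_dispA : measure_display;
  pri_dispB : measure_display;
  pri_spaceA : measurableType pri_dispA;
  pri_spaceB : measurableType pri_dispB;
  pri_probA : probability pri_spaceA R;
  pri_probB : probability pri_spaceB R;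
  pri_tree : protocol (X * pri_spaceA) (Y * pri_spaceB);
  pri_meas : measurable_protocol pri_tree
}.
Arguments pri_probA {R X Y} p : rename.
Arguments pri_probB {R X Y} p : rename.
Arguments pri_tree {R X Y} p : rename.

(* The two random strings are independent: their joint law is the product. *)
Definition pri_computes (R : realType) (X Y : Type) (F : X -> Y -> bool)
    (eps : R) (p : pri_protocol R X Y) : Prop :=
  forall x y,
    ((pri_probA p \x pri_probB p)
       [set r | output (pri_tree p) (x, r.1) (y, r.2) != F x y]
     <= eps%:E)%E.

Definition pri_cost (R : realType) (X Y : Type) (p : pri_protocol R X Y)
    : \bar R :=
  ereal_sup [set (comm R (pri_tree p) t.1 t.2)%:E
            | t in [set: (X * pri_spaceA p) * (Y * pri_spaceB p)]].

(* Every finite cost is the base-2 logarithm of a positive integer, so whenever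
   some protocol has finite cost these infima are minima. *)
Definition Rpub (R : realType) (X Y : Type) (eps : R) (F : X -> Y -> bool)
    : \bar R :=
  ereal_inf [set c | exists2 p : pub_protocol R X Y,
    pub_computes F eps p & c = pub_cost p].

Definition Rpri (R : realType) (X Y : Type) (eps : R) (F : X -> Y -> bool)
    : \bar R :=
  ereal_inf [set c | exists2 p : pri_protocol R X Y,
    pri_computes F eps p & c = pri_cost p].

(* Main.v *)
(* Newman's argument: replace the public string by one of m strings fixed in
   advance, where m is the integer part of 6n / (eps delta^2); Alice picks one
   uniformly with her private coins and announces its index at cost log m.
   The m strings are chosen greedily, so no product space is needed: with
   err i w the event that the string w errs on the input pair i, the potential
   sum_i (1 + delta)^(number of chosen w with err i w) grows by a factor at most
   1 + eps delta in expectation over a fresh w, hence for some w.  The Chernoff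
   estimate (1 + delta) ln (1 + delta) - delta >= delta^2 / 3 then shows that no
   input pair can have more than m eps (1 + delta) erring strings. *)
From HB Require Import structures.
Require Import Defs.
From mathcomp Require Import all_boot all_order all_algebra.
From mathcomp Require Import all_classical all_reals all_analysis.
From mathcomp Require Import measurable_realfun ring lra.

Set Implicit Arguments.
Unset Strict Implicit.
Unset Printing Implicit Defensive.

Import Order.TTheory GRing.Theory Num.Theory.
Local Open Scope classical_set_scope.
Local Open Scope ring_scope.

(** * Greedy choice of the strings *)

(** Averaging over [w]: by linearity the mean of the left side is at most the right side. The sum
    depends on [w] only through a finite error pattern, so a minimiser exists, and its value is at
    most the mean. *)
Lemma exists_weighted_sum_le (R : realType) (d : measure_display)
    (T : measurableType d) (P : probability T R) (I : finType)
    (err : I -> T -> bool) (eps : R) (a : I -> R) :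
  (forall i, measurable [set w | err i w]) ->
  (forall i, (P [set w | err i w] <= eps%:E)%E) ->
  (forall i, 0 <= a i) ->
  exists w, \sum_i a i * (err i w)%:R <= eps * \sum_i a i.
Proof.
move=> merr errle a_ge0.
have [w wmin] : exists w, forall w',
    \sum_i a i * (err i w)%:R <= \sum_i a i * (err i w')%:R.
  pose attained (p : {ffun I -> bool}) :=
    `[< exists w, p = [ffun i => err i w] >].
  have att0 : attained [ffun i => err i point] by apply/asboolP; exists point.
  case: (@arg_minP _ R _ [ffun i => err i point] attained
    (fun p => \sum_i a i * (p i)%:R) att0) => p /asboolP[w ->] wmin.
  exists w => w'.
  have /wmin : attained [ffun i => err i w'] by apply/asboolP; exists w'.
  by under eq_bigr do rewrite ffunE; under [leRHS]eq_bigr do rewrite ffunE.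
exists w; rewrite -lee_fin.
pose f i w' : \bar R := ((a i)%:E * (\1_[set w | err i w] w')%:E)%E.
have mind i :
    measurable_fun setT (EFin \o (\1_[set w | err i w] : T -> R)).
  by apply/measurable_EFinP; exact: measurable_indic.
have mf i : measurable_fun setT (f i).
  exact: (measurable_funeM (a i)%:E (mind i)).
have ind_ge0 i w' : (0 <= (\1_[set w | err i w] w' : R)%:E)%E.
  by rewrite lee_fin.
have fE w' : (\sum_i f i w' = (\sum_i a i * (err i w')%:R)%:E)%E.
  rewrite sumEFin; congr EFin; apply: eq_bigr => i _ /=.
  by rewrite indicE; congr (_ * _%:R); congr nat_of_bool; exact: asboolb.
have -> : ((\sum_i a i * (err i w)%:R)%:E
    = \int[P]_w' (cst (\sum_i a i * (err i w)%:R)%:E w'))%E.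
  by rewrite integral_cst// [X in (_ * X)%E]probability_setT mule1.
apply: (@le_trans _ _ (\int[P]_w' (\sum_i f i w'))%E).
  apply: ge0_le_integral => //=.
  - by move=> w' _; rewrite lee_fin sumr_ge0// => i _; exact: mulr_ge0.
  - exact: emeasurable_sum mf.
  - by move=> w' _; rewrite fE lee_fin.
rewrite ge0_integral_sum//; last by move=> i w' _; rewrite mule_ge0// lee_fin.
rewrite mulr_sumr -sumEFin; apply: lee_sum => i _.
rewrite (ge0_integralZl_EFin _ _ _ (mind i))//; last first.
  by move=> w' _; exact: ind_ge0.
rewrite integral_indic// setIT mulrC EFinM.
by apply: lee_wpmul2l; [rewrite lee_fin | exact: errle].
Qed.

Lemma exists_sample (R : realType) (d : measure_display)
    (T : measurableType d) (P : probability T R) (I : finType)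
    (err : I -> T -> bool) (eps del : R) (m : nat) :
  (forall i, measurable [set w | err i w]) ->
  (forall i, (P [set w | err i w] <= eps%:E)%E) ->
  0 <= eps -> 0 <= del ->
  exists2 s : seq T, size s = m &
    \sum_i (1 + del) ^+ count (err i) s <= #|I|%:R * (1 + eps * del) ^+ m.
Proof.
move=> merr errle eps0 del0; elim: m => [|m [s sm IHm]].
  by exists [::]; rewrite // expr0 mulr1 /= sumr_const.
have [|w wle] := @exists_weighted_sum_le _ _ _ P _ _ eps
  (fun i => (1 + del) ^+ count (err i) s) merr errle.
  by move=> i; rewrite exprn_ge0// addr_ge0.
exists (w :: s); first by rewrite /= sm.
rewrite exprS mulrCA.
apply: (@le_trans _ _ ((1 + eps * del) * \sum_i (1 + del) ^+ count (err i) s)).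
  (* For a bit e, (1 + del)^e = 1 + del e, so the growth of the potential is linear in the new
     errors. *)
  have -> : \sum_i (1 + del) ^+ count (err i) (w :: s) =
      \sum_i (1 + del) ^+ count (err i) s +
      del * \sum_i (1 + del) ^+ count (err i) s * (err i w)%:R.
    rewrite mulr_sumr -big_split; apply: eq_bigr => i _ /=.
    by rewrite exprD; case: (err i w); rewrite /= ?expr1 ?expr0; ring.
  rewrite mulrDl mul1r lerD2l (mulrC eps) -mulrA.
  by rewrite ler_wpM2l.
by rewrite ler_wpM2l// addr_ge0// mulr_ge0.
Qed.

(** * Logarithmic estimates and the Chernoff bound *)

(** The two sides agree at 0, and their difference has derivative y^2 / ((1 + y) (2 + y)^2) >= 0. *)
Lemma ln1D_ge (R : realType) (x : R) : 0 <= x -> 2 * x / (2 + x) <= ln (1 + x).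
Proof.
move=> x0.
pose f (y : R) := ln (1 + y) - 2 * y / (2 + y).
have df (y : R) : 0 <= y ->
    is_derive y 1 f ((1 + y)^-1 - 4 / (2 + y) ^+ 2).
  move=> y0; have y1 : 0 < 1 + y by lra.
  have y2 : 2 + y != 0 by apply/eqP; lra.
  have := is_derive1_ln y1 => dln.
  rewrite /f.
  apply: is_derive_eq.
  rewrite /GRing.scale /=; field.
  by rewrite y2 /=; apply/eqP; lra.
have : f 0 <= f x.
  apply: (@ger0_derive1_le_cc _ f 0 x); rewrite ?in_itv/= ?lexx ?x0//.
  - by move=> y; rewrite in_itv/= => /andP[/ltW/df[]].
  - move=> y; rewrite in_itv/= => /andP[/ltW y0 _].
    have [_] := df y y0; rewrite derive1E => ->.
    have y1 : 0 < 1 + y by lra.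
    have y2 : 0 < 2 + y by lra.
    have -> : (1 + y)^-1 - 4 / (2 + y) ^+ 2 =
        y ^+ 2 / ((1 + y) * (2 + y) ^+ 2).
      by field; rewrite !gt_eqF.
    by rewrite divr_ge0 ?sqr_ge0// mulr_ge0 ?sqr_ge0// ltW.
  - apply: derivable_within_continuous => y; rewrite in_itv/= => /andP[/df[]//].
by rewrite /f addr0 ln1 mulr0 mul0r subrr subr_ge0.
Qed.

Lemma chernoff_exponent_ge (R : realType) (del : R) :
  0 < del -> del <= 1 -> del ^+ 2 / 3 <= (1 + del) * ln (1 + del) - del.
Proof.
move=> d0 d1; apply: (@le_trans _ _ (del ^+ 2 / (2 + del))).
  rewrite ler_pM2l ?exprn_gt0// lef_pV2 ?posrE; lra.
have -> : del ^+ 2 / (2 + del) = (1 + del) * (2 * del / (2 + del)) - del.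
  by field; apply/eqP; lra.
by rewrite lerD2r ler_pM2l ?ln1D_ge//; lra.
Qed.

(* The slack 1 - ln 2 >= 1/12 pays for rounding the sample size down to an
   integer in the theorem. *)
Lemma ln2_le (R : realType) : ln (2 : R) <= 11 / 12.
Proof.
rewrite -[leRHS]expRK ler_ln ?posrE ?expR_gt0//.
(* Applied directly at 11/12, 1 + x <= e^x falls short of 2; at half the exponent, (35/24)^2 exceeds
   2. *)
have -> : 11 / 12 = 2%:R * (11 / 24) :> R by field.
rewrite expRM_natl; apply: (@le_trans _ _ ((1 + 11 / 24) ^+ 2)); first lra.
by rewrite lerXn2r ?nnegrE ?expR_ge0 ?expR_ge1Dx//; lra.
Qed.

(** All terms of the potential are nonnegative, so a single pair with too many errors would already
    push it above its bound. *)
Lemma exists_good_sample (R : realType) (d : measure_display)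
    (T : measurableType d) (P : probability T R) (I : finType)
    (err : I -> T -> bool) (eps del : R) (m : nat) :
  (forall i, measurable [set w | err i w]) ->
  (forall i, (P [set w | err i w] <= eps%:E)%E) ->
  0 < eps -> 0 < del -> del <= 1 ->
  (0 < #|I|)%N -> ln #|I|%:R <= eps * del ^+ 2 / 3 * m%:R ->
  exists2 s : seq T, size s = m &
    forall i, (count (err i) s)%:R <= m%:R * (eps * (1 + del)).
Proof.
move=> merr errle e0 d0 d1 I0 lnI.
have [s sm sum_le] := exists_sample m merr errle (ltW e0) (ltW d0).
exists s => // i; rewrite leNgt; apply/negP => many.
have d1_gt0 : 0 < 1 + del by lra.
have lnd : 0 < ln (1 + del) by rewrite ln_gt0//; lra.
have : (1 + del) ^+ count (err i) s <= #|I|%:R * (1 + eps * del) ^+ m.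
  apply: le_trans sum_le; rewrite (bigD1 i)//= lerDl sumr_ge0// => j _.
  by rewrite exprn_ge0// ltW.
apply/negP; rewrite -ltNge.
rewrite -(lnK (x := 1 + del)) ?posrE// -expRM_natl.
apply: (@le_lt_trans _ _ (expR (ln #|I|%:R) * expR (eps * del) ^+ m)).
  rewrite lnK ?posrE ?ltr0n// ler_wpM2l//.
  rewrite lerXn2r ?nnegrE ?expR_ge0 ?expR_ge1Dx//.
  by rewrite addr_ge0// mulr_ge0// ltW.
rewrite -expRM_natl -expRD ltr_expR.
(* The exponent is at most m eps (del^2 / 3 + del), by the hypothesis on [ln #|I|], and the Chernoff
   estimate bounds this. *)
apply: (@le_lt_trans _ _ (m%:R * (eps * (1 + del)) * ln (1 + del))).
  have := chernoff_exponent_ge d0 d1 => ce.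
  have me0 : 0 <= m%:R * eps :> R by rewrite mulr_ge0// ltW.
  have := ler_wpM2l me0 ce.
  lra.
by rewrite ltr_pM2r.
Qed.

(** * The private-coin simulation *)

(** The uniform law on 0..b, carried by [nat] because every subset there is measurable. *)
Definition uniform_nat (R : realType) (b : nat) : set nat -> \bar R :=
  mscale ((b.+1%:R : R)^-1)%:nng (msum (fun k => @dirac _ nat k R) b.+1).

HB.instance Definition _ (R : realType) (b : nat) :=
  Measure.on (uniform_nat R b).

Lemma uniform_nat_pred (R : realType) (b : nat) (p : pred nat) :
  uniform_nat R b [set k | p k] = ((count p (iota 0 b.+1))%:R / b.+1%:R)%:E.
Proof.
rewrite /uniform_nat /mscale mulrC EFinM; congr (_ * _)%E; rewrite /msum.
rewrite -sum1_count natr_sum -sumEFin -[iota 0 b.+1]/(index_iota 0 b.+1).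
rewrite big_mkord [RHS]big_mkcond /=; apply: eq_bigr => k _.
by rewrite [LHS]diracE mem_setE unfold_in; case: (p k).
Qed.

Lemma uniform_nat_setT (R : realType) (b : nat) :
  uniform_nat R b setT = 1%E.
Proof.
have -> : [set: nat] = [set k | xpredT k] by apply/seteqP; split.
by rewrite uniform_nat_pred count_predT size_iota divff.
Qed.

HB.instance Definition _ (R : realType) (b : nat) :=
  Measure_isProbability.Build _ _ _ (uniform_nat R b) (uniform_nat_setT R b).

Fixpoint map_view (A B A' B' : Type) (f : A' -> A) (g : B' -> B)
    (p : protocol A B) : protocol A' B' :=
  match p with
  | OutA o => OutA _ (o \o f)
  | OutB o => OutB _ (o \o g)
  | SendA b m k => SendA (m \o f) (fun j => map_view f g (k j))
  | SendB b m k => SendB (m \o g) (fun j => map_view f g (k j))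
  end.

Lemma output_map_view (A B A' B' : Type) (f : A' -> A) (g : B' -> B)
    (p : protocol A B) (u : A') (v : B') :
  output (map_view f g p) u v = output p (f u) (g v).
Proof. by elim: p => //= b m k IH; rewrite IH. Qed.

Lemma comm_map_view (R : realType) (A B A' B' : Type) (f : A' -> A)
    (g : B' -> B) (p : protocol A B) (u : A') (v : B') :
  comm R (map_view f g p) u v = comm R p (f u) (g v).
Proof. by elim: p => //= b m k IH; rewrite IH. Qed.

Lemma measurable_protocol_discrete (X Y : Type)
    (p : protocol (X * nat) (Y * unit)) : measurable_protocol p.
Proof. by elim: p => //=. Qed.

(* Alice's first message is the sampled index, so Bob needs no randomness and
   his space is a point. *)
Definition sampled_protocol (R : realType) (X Y : Type) (b : nat)
    (t : nat -> protocol X Y) : pri_protocol R X Y :=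
  @PriProtocol R X Y _ _ nat unit (uniform_nat R b) (@dirac _ unit tt R)
    (SendA (fun u : X * nat => inord u.2 : 'I_b.+1)
       (fun j => map_view fst fst (t j)))
    (@measurable_protocol_discrete X Y _).

Lemma sampled_protocol_computes (R : realType) (X Y : Type)
    (F : X -> Y -> bool) (b : nat) (t : nat -> protocol X Y) (e : R) :
  (forall x y, (count (fun k => output (t k) x y != F x y) (iota 0 b.+1))%:R
                 <= b.+1%:R * e) ->
  pri_computes F e (sampled_protocol R b t).
Proof.
move=> cnt x y; rewrite /pri_computes /=.
(* Out-of-range values of [inord] do not matter: the law only charges k <= b, where [inord] is the
   identity. *)
set p := fun k : nat => output (t (inord k : 'I_b.+1)) x y != F x y.
rewrite (_ : [set r | _] = [set k | p k] `*` setT); last first.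
  by apply/seteqP; split => -[k []] /=; rewrite output_map_view//= => -[].
rewrite product_measure1E//.
rewrite [X in (_ * X)%E]probability_setT mule1.
rewrite [X in (X <= _)%E]uniform_nat_pred lee_fin ler_pdivrMr// mulrC.
apply: le_trans (cnt x y); rewrite ler_nat; apply: eq_leq.
apply: eq_in_count => k; rewrite mem_iota add0n => /andP[_ kb].
by rewrite /p inordK.
Qed.

Lemma sampled_protocol_cost (R : realType) (X Y : Type) (b : nat)
    (t : nat -> protocol X Y) (c : \bar R) :
  (forall k x y, (k < b.+1)%N -> ((comm R (t k) x y)%:E <= c)%E) ->
  (pri_cost (sampled_protocol R b t) <= c + (log2 b.+1%:R)%:E)%E.
Proof.
move=> tc; apply: ge_ereal_sup => _ [[[x k] [y []]] _ <-] /=.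
rewrite comm_map_view /= addrC EFinD leeD2r//.
exact/tc/ltn_ord.
Qed.

Lemma log2M (R : realType) (x y : R) :
  0 < x -> 0 < y -> log2 (x * y) = log2 x + log2 y.
Proof. by move=> x0 y0; rewrite /log2 lnM ?posrE// mulrDl. Qed.

Theorem theorem1p6 (R : realType) (n : nat)
    (F : n.-tuple bool -> n.-tuple bool -> bool) (eps delta : R) :
  (0 < n)%N ->
  0 < eps -> eps < 1 / 2 ->
  0 < delta -> delta <= 1 ->
  (Rpri (eps * (1 + delta)) F <=
     Rpub eps F + (log2 (n%:R / eps))%:E + (log2 (6 / delta ^+ 2))%:E)%E.
Proof.
move=> n0 e0 e2 d0 d1.
have n1 : 1 <= n%:R :> R by rewrite ler1n.
have ed0 : 0 < eps * delta ^+ 2 by rewrite mulr_gt0// exprn_gt0.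
have ed1 : eps * delta ^+ 2 <= 1 / 2.
  by apply: le_trans (ltW e2); rewrite ler_piMr ?exprn_ile1// ltW.
rewrite -addeA -EFinD -log2M; last 2 first.
- by rewrite divr_gt0// ltr0n.
- by rewrite divr_gt0// exprn_gt0.
set S := (_ / _ * (_ / _)).
have SE : S * (eps * delta ^+ 2) = 6 * n%:R.
  by rewrite /S; field; rewrite !gt_eqF.
(* Since eps delta^2 <= 1/2. In particular S >= 12, so rounding down leaves at least one string. *)
have S12 : 12 * n%:R <= S.
  rewrite -(ler_pM2r ed0) SE; nra.
have S0 : 0 <= S by apply: le_trans S12; rewrite mulr_ge0.
have /andP[mS Sm] := truncn_itv S0.
set m := Num.truncn S in mS Sm.
have m0 : (0 < m)%N.
  rewrite -(ltr_nat R); move: Sm; rewrite -natr1; lra.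
(* The logarithm is finite, so it can be moved across and the public protocols treated one at a
   time. *)
rewrite -leeBlDr//; apply: le_ereal_inf_tmp => _ [p perr ->].
rewrite leeBlDr//.
pose err (xy : n.-tuple bool * n.-tuple bool) w :=
  output (pub_tree p w) xy.1 xy.2 != F xy.1 xy.2.
have [] := @exists_good_sample R _ _ (pub_prob p) _ err eps delta m.
- move=> [x y]; rewrite /err/=.
  have := @pub_meas _ _ _ p x y measurableT [set b | b != F x y] I.
  by rewrite setTI.
- by move=> [x y]; exact: perr.
- by [].
- by [].
- by [].
- by rewrite card_prod card_tuple card_bool muln_gt0 expn_gt0.
(* There are 2^(2n) input pairs. As m > S - 1, the right side is at least (6n - 1/2) / 3 = 2n - 1/6,
   while 2n ln 2 <= 2n - n/6. *)
- rewrite card_prod card_tuple card_bool -expnD natrX lnXn//.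
  have -> : ln (2 : R) *+ (n + n) = 2 * n%:R * ln 2.
    by rewrite -[LHS]mulr_natl natrD; ring.
  have := ln2_le R => l2.
  move: Sm; rewrite -natr1 => Sm.
  have := ler_wpM2l (ler0n R n) l2.
  have : (S - 1) * (eps * delta ^+ 2) <= m%:R * (eps * delta ^+ 2).
    by rewrite ler_pM2r//; lra.
  lra.
move=> s sm good.
case: m m0 mS sm {Sm} good => // b _ mS sb good.
(* Indices stay below [size s], so the default [point] is never selected. *)
pose t k := pub_tree p (nth point s k).
apply: (@le_trans _ _ (pri_cost (sampled_protocol R b t))).
  apply: ereal_inf_lbound; exists (sampled_protocol R b t) => //.
  apply: sampled_protocol_computes => x y.
  have := good (x, y); rewrite -{1}(mkseq_nth point s) count_map sb.
  exact: le_trans.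
apply: (@le_trans _ _ (pub_cost p + (log2 b.+1%:R)%:E)%E).
  apply: sampled_protocol_cost => k x y _; apply: ereal_sup_ubound.
  by exists ((x, y), nth point s k).
rewrite leeD2l// lee_fin /log2 ler_pM2r ?invr_gt0 ?ln_gt0 ?ltr1n//.
by rewrite ler_ln ?posrE// (lt_le_trans _ mS).
Qed.
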